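(* Let $\Gamma$ be a tight digraph of degree $d\geq 1$ and order $n=\Delta_d x^d$ for some $x\in C_d\cap\mathbb{N}$. Then all the elements of the family of dilates $\{m\Gamma:\ m\geq 1\}$ are tight.
   Context: In this context ''digraph'' means a Cayley digraph $\Gamma=\mathrm{Cay}(G,T)$ of a finite Abelian group $G$ with respect to a generating set $T\subset G$ with $0\notin T$: its vertex set is $G$ and its arcs are $g\to g+t$ for $g\in G$, $t\in T$. Its order is $\mathrm{ord}(\Gamma)=|\Gamma|=|G|$, its degree is $\deg(\Gamma)=|T|$, and $k(\Gamma)$ denotes its (directed) diameter. $\mathbb{N}$ is the set of nonnegative integers. The solid density of a digraph $\Gamma$ of degree $d$ and order $n$ is $\delta(\Gamma)=\dfrac{n}{(k(\Gamma)+d)^d}$, and $\Delta_d=\sup\{\delta(\Gamma):\ \deg(\Gamma)=d\}$ (a finite positive real number). Put $\ell(d,n)=\left\lceil\sqrt[d]{n/\Delta_d}\,\right\rceil-d$. The tightness of a digraph $\Gamma$ of degree $d$ and order $n$ is $t(d,\Gamma)=k(\Gamma)-\ell(d,n)$, and $\Gamma$ is called tight when $t(d,\Gamma)=0$. Also $C_d=\{x\in\mathbb{R}:\ \Delta_d x^d\in\mathbb{N}\}$. Dilates: let $\Gamma=\mathrm{Cay}(G,\{g_1,\dots,g_d\})$ be a digraph of degree $d$, and let $M\in\mathbb{Z}^{d\times d}$ be a matrix whose columns form a basis of the kernel lattice of $\mathbb{Z}^d\to G$, $(a_1,\dots,a_d)\mapsto\sum_i a_ig_i$. Let $\mathrm{diag}(s_1,\dots,s_d)=UMV$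 be a Smith normal form decomposition ($U,V$ unimodular, $s_1\mid\cdots\mid s_d$). Then $\Gamma\cong\mathrm{Cay}(\mathbb{Z}^d/M\mathbb{Z}^d,\{e_1,\dots,e_d\})\cong\mathrm{Cay}(\mathbb{Z}_{s_1}\oplus\cdots\oplus\mathbb{Z}_{s_d},\{Ue_1,\dots,Ue_d\})$, where $e_1,\dots,e_d$ is the canonical basis of $\mathbb{Z}^d$; the set $\{Ue_1,\dots,Ue_d\}$ is called a proper generating set. For an integer $m\ge 1$, the dilate $m\Gamma$ is $m\Gamma=\mathrm{Cay}(\mathbb{Z}_{ms_1}\oplus\cdots\oplus\mathbb{Z}_{ms_d},\{Ue_1,\dots,Ue_d\})\cong\mathrm{Cay}(\mathbb{Z}^d/mM\mathbb{Z}^d,\{e_1,\dots,e_d\})$, a digraph of degree $d$ and order $m^d|\Gamma|$. *)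

(* Defs.v *)
(* MathComp + MathComp-Analysis. *)
From HB Require Import structures.
From mathcomp Require Import all_boot all_order all_algebra all_fingroup.
From mathcomp Require Import all_classical all_reals all_analysis.
Set Implicit Arguments.
Unset Strict Implicit.
Unset Printing Implicit Defensive.
Import Order.TTheory GRing.Theory Num.Theory.
Local Open Scope ring_scope.

Definition cay_arc (G : finZmodType) (T : {set G}) : rel G :=
  fun g h => [exists t in T, h == g + t].

Definition walk_of_length (V : finType) (e : rel V) (u v : V) (n : nat) : bool :=
  [exists p : n.-tuple V, path e u p && (last u p == v)].

(* Length of a shortest walk from u to v. A shortest walk repeats no vertex,
   so its length is below #|V|; the value #|V| means that v is unreachable,
   which never happens when T generates G. *)
Definition dist (V : finType) (e : rel V) (u v : V) : nat :=
  find (walk_of_length e u v) (iota 0 #|V|).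

Definition diameter (V : finType) (e : rel V) : nat :=
  \max_(u : V) \max_(v : V) dist e u v.

(* The subgroup <<T>> is taken for the addition of G: the finGroupType
   underlying a finZmodType is its additive group. *)
Definition is_cay_digraph (G : finZmodType) (T : {set G}) (d : nat) : Prop :=
  [/\ 0 \notin T, <<T>>%g = [set: G]%SET & #|T| = d].

Definition cay_diameter (G : finZmodType) (T : {set G}) : nat :=
  diameter (cay_arc T).

Definition solid_density (R : realType) (G : finZmodType) (T : {set G}) : R :=
  #|G|%:R / ((cay_diameter T + #|T|) ^ #|T|)%:R.

Definition Delta (R : realType) (d : nat) : R :=
  sup [set r : R | exists (G : finZmodType) (T : {set G}),
                     is_cay_digraph T d /\ r = solid_density R T]%classic.

(* The difference is taken in int: it is not truncated at 0. *)
Definition ell (R : realType) (d n : nat) : int :=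
  Num.ceil ((n%:R / Delta R d) `^ (d%:R^-1)) - d%:Z.

Definition tightness (R : realType) (G : finZmodType) (T : {set G}) : int :=
  (cay_diameter T)%:Z - ell R #|T| #|G|.

Definition is_tight_digraph (R : realType) (G : finZmodType) (T : {set G})
    (d : nat) : Prop :=
  is_cay_digraph T d /\ tightness R T = 0.

Definition Cset (R : realType) (d : nat) : set R :=
  [set x : R | exists N : nat, Delta R d * x ^+ d = N%:R]%classic.
Arguments Cset : clear implicits.

(* The group Z_(n 0) (+) ... (+) Z_(n (d-1)). Since 'I_p.+1 carries addition
   modulo p.+1, the factor 'I_(n i).-1.+1 is Z_(n i) as soon as 0 < n i,
   including the trivial group when n i = 1 (which 'Z_(n i) would get wrong). *)
Definition cyclic_sum (d : nat) (n : 'I_d -> nat) : Type :=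
  {dffun forall i : 'I_d, 'I_(n i).-1.+1}.

HB.instance Definition _ (d : nat) (n : 'I_d -> nat) :=
  Finite.on (cyclic_sum n).

Section CyclicSumZmodule.
Variables (d : nat) (n : 'I_d -> nat).
Implicit Types a b c : cyclic_sum n.

Definition cyclic_sum_zero : cyclic_sum n :=
  [ffun i => (0 : 'I_(n i).-1.+1)].
Definition cyclic_sum_opp a : cyclic_sum n :=
  [ffun i => - (a i : 'I_(n i).-1.+1)].
Definition cyclic_sum_add a b : cyclic_sum n :=
  [ffun i => (a i : 'I_(n i).-1.+1) + b i].

Lemma cyclic_sum_addA : associative cyclic_sum_add.
Proof. by move=> a b c; apply/ffunP => i; rewrite !ffunE addrA. Qed.
Lemma cyclic_sum_addC : commutative cyclic_sum_add.
Proof. by move=> a b; apply/ffunP => i; rewrite !ffunE addrC. Qed.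
Lemma cyclic_sum_add0 : left_id cyclic_sum_zero cyclic_sum_add.
Proof. by move=> a; apply/ffunP => i; rewrite !ffunE add0r. Qed.
Lemma cyclic_sum_addN : left_inverse cyclic_sum_zero cyclic_sum_opp cyclic_sum_add.
Proof. by move=> a; apply/ffunP => i; rewrite !ffunE addNr. Qed.

HB.instance Definition _ := GRing.isZmodule.Build (cyclic_sum n)
  cyclic_sum_addA cyclic_sum_addC cyclic_sum_add0 cyclic_sum_addN.
End CyclicSumZmodule.

(* The columns of M form a Z-basis of the kernel of
   Z^d -> G, a |-> \sum_i a_i g_i. *)
Definition is_kernel_basis (G : finZmodType) (d : nat) (g : 'I_d -> G)
    (M : 'M[int]_d) : Prop :=
  (forall b : 'cV[int]_d, M *m b = 0 -> b = 0) /\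
  (forall a : 'cV[int]_d,
     \sum_(i < d) g i *~ a i 0 = 0 <-> exists b : 'cV[int]_d, a = M *m b).

Definition is_smith_decomposition (d : nat) (M U V : 'M[int]_d)
    (s : 'I_d -> nat) : Prop :=
  [/\ U \in unitmx, V \in unitmx,
      diag_mx (\row_(i < d) (s i)%:Z) = U *m M *m V
    & forall i j : 'I_d, (i <= j)%N -> (s i %| s j)%N].

(* s and U arise from Cay(G, T) by ordering T as g_0, ..., g_(d-1), choosing a
   basis M of the kernel lattice and a Smith decomposition of M; all of these
   choices are allowed. *)
Definition is_smith_presentation (G : finZmodType) (T : {set G}) (d : nat)
    (s : 'I_d -> nat) (U : 'M[int]_d) : Prop :=
  exists (g : 'I_d -> G) (M V : 'M[int]_d),
    [/\ injective g, T = [set g i | i in 'I_d]%SET,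
        is_kernel_basis g M & is_smith_decomposition M U V s].

(* The set {U e_0, ..., U e_(d-1)} in Z_(n 0) (+) ... (+) Z_(n (d-1)): the
   component j of U e_i is the class of U j i, that is, U j i times Zp1. *)
Definition proper_generating_set (d : nat) (n : 'I_d -> nat) (U : 'M[int]_d)
    : {set cyclic_sum n} :=
  [set ([ffun j => (Zp1 : 'I_(n j).-1.+1) *~ U j i] : cyclic_sum n)
     | i in 'I_d]%SET.

(* The dilate m Gamma is the Cayley digraph of cyclic_sum (fun i => m * s i)
   with respect to this set, (s, U) being a Smith presentation of Gamma. *)
Definition dilate (m d : nat) (s : 'I_d -> nat) (U : 'M[int]_d)
    : {set cyclic_sum (fun i => m * s i)%N} :=
  proper_generating_set (fun i => m * s i)%N U.

(* Main.v *)
(* Since |G| = Delta_d x^d, tightness of Gamma says k(Gamma) + d = x. Every a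
   in Z^d is m q + r with 0 <= r_i < m; replacing q by a nonnegative q' of
   weight at most k(Gamma), congruent to q modulo the kernel lattice, gives
   k(m Gamma) + d <= m (k(Gamma) + d) = m x. Conversely m Gamma is a Cayley
   digraph of degree d and order m^d |G| = Delta_d (m x)^d, and its density is
   at most Delta_d, so k(m Gamma) + d >= m x. Hence equality, and m x - d is
   exactly ell(d, |m Gamma|). *)
From HB Require Import structures.
Require Import Defs.
From mathcomp Require Import all_boot all_order all_algebra all_fingroup.
From mathcomp Require Import all_classical all_reals all_analysis.
Import Order.TTheory GRing.Theory Num.Theory.
Local Open Scope ring_scope.

(** * Walks in a Cayley digraph as nonnegative combinations of generators *)

(** When the [g i] generate a finite [G], this is the condition that the diameter is at most [k],
    freed from walks and vertices. *)
Definition covers {G : zmodType} {d : nat} (g : 'I_d -> G) (k : nat) : Prop :=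
  forall v : G, exists2 c : 'I_d -> nat,
    (\sum_i c i <= k)%N & v = \sum_i g i *+ c i.

Lemma walk_of_lengthS (V : finType) (e : rel V) (u v : V) (n : nat) :
  reflect (exists2 w, e u w & walk_of_length e w v n)
          (walk_of_length e u v n.+1).
Proof.
apply: (iffP existsP) => [[p]|[w euw /existsP [p /andP [pth lst]]]].
  case/tupleP: p => w p /= /andP [/andP [euw pth] lst].
  by exists w => //; apply/existsP; exists p; rewrite pth.
by exists (cons_tuple w p); rewrite /= euw pth.
Qed.

(** The group is Abelian, so the endpoint of a walk depends only on how many times [c i] each
    generator is used. *)
Lemma walk_of_cayP {G : finZmodType} {d : nat} (g : 'I_d -> G) (n : nat)
    (u v : G) :
  reflect (exists2 c : 'I_d -> nat, (\sum_i c i = n)%N & v = u + \sum_i g i *+ c i)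
          (walk_of_length (cay_arc [set g i | i in 'I_d]%SET) u v n).
Proof.
elim: n u v => [|n IHn] u v.
  apply: (iffP existsP) => [[p]|[c c0 ->]].
    rewrite tuple0 /= => /eqP <-; exists (fun=> 0%N); first by rewrite big1.
    by rewrite big1 ?addr0.
  exists [tuple] => /=; rewrite big1 ?addr0 // => i _.
  by move/eqP: c0; rewrite sum_nat_eq0 => /forallP /(_ i) /eqP ->.
have incr (f : 'I_d -> nat) (i : 'I_d) (x : G) :
    x + \sum_j g j *+ ((j == i) + f j) = (x + g i) + \sum_j g j *+ f j.
  under eq_bigr => j _ do rewrite mulrnDr.
  rewrite big_split /= (bigD1 i) //= eqxx mulr1n big1 => [|j /negPf ->] //.
  by rewrite addr0 addrA.
have sum_incr (f : 'I_d -> nat) (i : 'I_d) :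
    (\sum_j ((j == i) + f j) = (\sum_j f j).+1)%N.
  rewrite big_split /= (bigD1 i) //= eqxx big1 => [|j /negPf ->] //.
apply: (iffP (walk_of_lengthS _ _ _ _ _)).
  move=> [_ /existsP [_ /andP [/imsetP [i _ ->] /eqP ->]]].
  move=> /IHn [c cn ->]; exists (fun j => (j == i) + c j)%N.
    by rewrite sum_incr cn.
  by rewrite incr.
move=> [c cn ->].
have [i ci] : exists i, (0 < c i)%N.
  apply/existsP; apply: contra_eqT cn => /existsPn c0.
  by rewrite big1 // => i _; apply/eqP; rewrite -leqn0 leqNgt c0.
(* A generator with [0 < c i] serves as first arc, so the truncated subtraction below loses
   nothing. *)
have cE j : c j = ((j == i) + (c j - (j == i)))%N.
  by case: eqP => [->|_]; rewrite ?subnKC ?subn0.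
exists (u + g i).
  by apply/existsP; exists (g i); rewrite imset_f ?eqxx.
apply/IHn; exists (fun j => c j - (j == i))%N.
  by apply: succn_inj; rewrite -cn -(sum_incr _ i); apply: eq_bigr => j _.
by rewrite -incr; congr (_ + _); apply: eq_bigr => j _; rewrite -cE.
Qed.

Lemma dist_leq (V : finType) (e : rel V) (u v : V) (n : nat) :
  walk_of_length e u v n -> (dist e u v <= n)%N.
Proof.
move=> walk; case: (ltnP n #|V|) => [nV|Vn].
  rewrite leqNgt; apply/negP => /(before_find 0%N).
  by rewrite nth_iota // add0n walk.
by apply: leq_trans Vn; rewrite -[X in (_ <= X)%N](size_iota 0) find_size.
Qed.

(** Removing repeated vertices from a path brings its length below [#|V|], within the range searched
    by [dist]. *)
Lemma walk_of_dist (V : finType) (e : rel V) (u v : V) :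
  connect e u v -> walk_of_length e u v (dist e u v).
Proof.
case/connectP => p pth ->; case/shortenP: pth => {}p pth uq _.
have ltpV : (size p < #|V|)%N by rewrite -/(size (u :: p)) -(card_uniqP uq) max_card.
have has_walk : has (walk_of_length e u (last u p)) (iota 0 #|V|).
  apply/hasP; exists (size p); first by rewrite mem_iota.
  by apply/existsP; exists (in_tuple p); rewrite /= pth eqxx.
have := nth_find 0%N has_walk.
by rewrite nth_iota // -[X in (_ < X)%N](size_iota 0) -has_find.
Qed.

Lemma cay_diameter_leq {G : finZmodType} {d : nat} (g : 'I_d -> G) (k : nat) :
  covers g k -> (cay_diameter [set g i | i in 'I_d]%SET <= k)%N.
Proof.
move=> cov; apply/bigmax_leqP => u _; apply/bigmax_leqP => v _.
have [c ck vE] := cov (v - u); apply: leq_trans ck.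
apply/dist_leq/walk_of_cayP; exists c => //.
by rewrite -vE addrC subrK.
Qed.

Lemma covers_cay_diameter {G : finZmodType} {d : nat} (g : 'I_d -> G) :
  <<[set g i | i in 'I_d]>>%g = [set: G]%SET ->
  covers g (cay_diameter [set g i | i in 'I_d]%SET).
Proof.
set T := [set g i | i in 'I_d]%SET => genT v.
(* Walks can be translated, so the set reachable from 0 is closed under addition; in a finite group
   it is then a subgroup, and it contains [T]. *)
pose S := [set w : G | connect (cay_arc T) 0 w]%SET.
have translate a u w :
    connect (cay_arc T) u w -> connect (cay_arc T) (a + u) (a + w).
  case/connectP => p; elim: p u => [|x p IHp] u /=.
    by move=> _ ->; apply: connect0.
  case/andP => /existsP [t /andP [tT /eqP ->]] pth /(IHp _ pth).
  apply: connect_trans; apply: connect1.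
  by apply/existsP; exists t; rewrite tT addrA eqxx.
have gS : group_set S.
  apply/group_setP; split=> [|a b]; first by rewrite inE; apply: connect0.
  rewrite !inE FinRing.zmodMgE => Sa /(translate a); rewrite addr0.
  exact: connect_trans.
have TS : T \subset Group gS.
  apply/fintype.subsetP => t tT; rewrite inE; apply: connect1.
  by apply/existsP; exists t; rewrite tT add0r eqxx.
have : v \in Group gS.
  by apply: (fintype.subsetP (etrans (gen_subG _ _) TS)); rewrite genT inE.
rewrite inE => /walk_of_dist /walk_of_cayP [c cE ->].
exists c; last by rewrite add0r.
rewrite cE /cay_diameter /diameter.
apply: leq_trans (leq_bigmax (0 : G)).
by apply: (leq_bigmax (F := fun w => dist (cay_arc T) 0 w) v).
Qed.

Lemma covers_gen {G : finZmodType} {d : nat} (g : 'I_d -> G) (k : nat) :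
  covers g k -> <<[set g i | i in 'I_d]>>%g = [set: G]%SET.
Proof.
move=> cov; apply/setP => v; rewrite inE; have [c _ ->] := cov v.
elim/big_ind: _ => [|a b Sa Sb|i _]; first exact: group1.
  by rewrite -FinRing.zmodMgE groupM.
by rewrite -FinRing.zmodXgE groupX // mem_gen ?imset_f.
Qed.

(** * Transfer of a covering bound to a dilate *)

(** Only two facts about the dilate enter: [h] spans [H] over the integers, and [m] times a relation
    of [g] is a relation of [h]. The term [d * m.-1] bounds the weight of the remainders modulo
    [m]. *)
Lemma covers_dilate {G H : zmodType} {d : nat} (g : 'I_d -> G) (h : 'I_d -> H)
    (m k : nat) :
  (0 < m)%N ->
  (forall v, exists a : 'cV[int]_d, v = \sum_i h i *~ a i 0) ->
  (forall a : 'cV[int]_d, \sum_i g i *~ a i 0 = 0 ->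
     \sum_i h i *~ (m%:Z * a i 0) = 0) ->
  covers g k -> covers h (m * k + d * m.-1).
Proof.
move=> m0 surj ker cov v; have [a ->] := surj v.
have [c ck gc] := cov (\sum_i g i *~ (a i 0%R %/ m)%Z).
have m0Z : m%:Z != 0 by rewrite -lt0n.
pose r i := `|(a i 0%R %% m)%Z|%N.
have rE i : (r i)%:Z = (a i 0%R %% m)%Z by rewrite /r gez0_abs ?modz_ge0.
exists (fun i => m * c i + r i)%N.
  rewrite big_split -big_distrr /= leq_add ?leq_mul //.
  rewrite -[X in (_ <= X * _)%N](card_ord d) -sum_nat_const leq_sum // => i _.
  rewrite -ltnS prednK // -ltz_nat rE; apply: ltz_pmod; exact: m0.
(* The quotient vector minus its replacement [c] is a relation of [g]; [m] times it is the original
   vector minus the chosen coefficients. *)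
pose b : 'cV[int]_d := \col_i ((a i 0%R %/ m)%Z - (c i)%:Z).
have /ker hb : \sum_i g i *~ b i 0 = 0.
  under eq_bigr => i _ do rewrite mxE mulrzBr.
  by rewrite sumrB gc subrr.
apply: subr0_eq; rewrite -sumrB -[RHS]hb; apply: eq_bigr => i _.
rewrite pmulrn -mulrzBr mxE; congr (_ *~ _).
rewrite {1}(divz_eq (a i 0%R) m) PoszD PoszM rE.
by rewrite mulrBr (mulrC m%:Z (_ %/ _)%Z) opprD addrACA subrr addr0.
Qed.

(** * Integer combinations in a sum of cyclic groups *)

(** A named projection, so that it can carry the additive morphism structure and commute with
    sums. *)
Definition cyclic_coord {d : nat} {n : 'I_d -> nat} (j : 'I_d)
    (y : cyclic_sum n) : 'I_(n j).-1.+1 := y j.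

Lemma cyclic_coord_is_zmod_morphism (d : nat) (n : 'I_d -> nat) (j : 'I_d) :
  zmod_morphism (@cyclic_coord d n j).
Proof. by move=> y z; rewrite /cyclic_coord !ffunE. Qed.

HB.instance Definition _ (d : nat) (n : 'I_d -> nat) (j : 'I_d) :=
  GRing.isZmodMorphism.Build (cyclic_sum n) 'I_(n j).-1.+1
    (@cyclic_coord d n j) (@cyclic_coord_is_zmod_morphism d n j).

Definition proper_generator {d : nat} (n : 'I_d -> nat) (U : 'M[int]_d)
    (i : 'I_d) : cyclic_sum n :=
  [ffun j => (Zp1 : 'I_(n j).-1.+1) *~ U j i].

Lemma Zp1_mulrz_eq0 (p : nat) (z : int) :
  ((Zp1 : 'I_p.+1) *~ z == 0) = (p.+1 %| z)%Z.
Proof.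
suff nat_case k : ((Zp1 : 'I_p.+1) *+ k == 0) = (p.+1 %| k)%N.
  by rewrite dvdzE; case: z => k; rewrite -?nat_case // NegzE mulrNz oppr_eq0.
by rewrite Zp_mulrn -val_eqE /= modnMml mul1n.
Qed.

Lemma cyclic_sum_eq0 (d : nat) (n : 'I_d -> nat) (y : cyclic_sum n) :
  (forall j, cyclic_coord j y = 0) -> y = 0.
Proof. by move=> y0; apply/ffunP => j; rewrite [RHS]ffunE; apply: y0. Qed.

Lemma cyclic_coord_comb (d : nat) (n : 'I_d -> nat) (U : 'M[int]_d)
    (a : 'cV[int]_d) (j : 'I_d) :
  cyclic_coord j (\sum_i proper_generator n U i *~ a i 0) =
  Zp1 *~ (U *m a) j 0.
Proof.
rewrite raddf_sum mxE mulrz_sumr; apply: eq_bigr => i _.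
by rewrite raddfMz /= /cyclic_coord /proper_generator ffunE mulrzA.
Qed.

(** Coefficients [a] yield the class of [U *m a], so integer representatives of the coordinates are
    lifted through the inverse of [U]. *)
Lemma proper_generator_surj {d : nat} (n : 'I_d -> nat) (U : 'M[int]_d)
    (y : cyclic_sum n) :
  U \in unitmx ->
  exists a : 'cV[int]_d, y = \sum_i proper_generator n U i *~ a i 0.
Proof.
move=> Uunit; exists (invmx U *m \col_j (val (cyclic_coord j y))%:Z).
apply: subr0_eq; apply: cyclic_sum_eq0 => j.
rewrite raddfB /= cyclic_coord_comb mulKVmx // mxE -pmulrn Zp_mulrn.
apply/eqP; rewrite subr_eq0 -val_eqE /= modnMml mul1n modn_small //.
Qed.

Lemma proper_generator_ker {d : nat} (n : 'I_d -> nat) (U : 'M[int]_d)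
    (a : 'cV[int]_d) :
  (forall j, (0 < n j)%N) ->
  (\sum_i proper_generator n U i *~ a i 0 = 0) <->
  (exists b : 'cV[int]_d, U *m a = diag_mx (\row_j (n j)%:Z) *m b).
Proof.
move=> n0; split=> [ker|[b ab]].
  have dvdU j : ((n j)%:Z %| (U *m a) j 0%R)%Z.
    by rewrite -(prednK (n0 j)) -Zp1_mulrz_eq0 -cyclic_coord_comb ker raddf0.
  exists (\col_j ((U *m a) j 0%R %/ n j)%Z); apply/colP => j.
  by rewrite mul_diag_mx [RHS]mxE [X in X * _]mxE [X in _ * X]mxE mulrC divzK.
apply: cyclic_sum_eq0 => j; apply/eqP.
rewrite cyclic_coord_comb Zp1_mulrz_eq0 prednK // ab mul_diag_mx !mxE.
exact: dvdz_mulr.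
Qed.

Lemma card_cyclic_sum {d : nat} (n : 'I_d -> nat) :
  (forall j, (0 < n j)%N) -> #|{: cyclic_sum n}| = (\prod_j n j)%N.
Proof.
move=> n0; rewrite card_dep_ffun foldrE big_map big_enum /=.
by apply: eq_bigr => j _; rewrite card_ord prednK.
Qed.

(** * Relation lattices and group orders *)

Lemma zcombB {G : zmodType} {d : nat} (g : 'I_d -> G) (a b : 'cV[int]_d) :
  \sum_i g i *~ (a - b) i 0 = \sum_i g i *~ a i 0 - \sum_i g i *~ b i 0.
Proof. by rewrite -sumrB; apply: eq_bigr => i _; rewrite !mxE mulrzBr. Qed.

(** Choosing coefficients for each element of [G] and evaluating them on [h] is injective: a
    collision gives a relation of [h], hence one of [g]. *)
Lemma ker_leq_card {G H : finZmodType} {d : nat} (g : 'I_d -> G)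
    (h : 'I_d -> H) :
  (forall v, exists a : 'cV[int]_d, v = \sum_i g i *~ a i 0) ->
  (forall a : 'cV[int]_d, \sum_i h i *~ a i 0 = 0 -> \sum_i g i *~ a i 0 = 0) ->
  (#|G| <= #|H|)%N.
Proof.
move=> surj ker; have [a aE] := choice surj.
apply: (@leq_card _ _ (fun v => \sum_i h i *~ a v i 0)) => v w eq_vw.
apply: subr0_eq; rewrite [v]aE [w]aE -zcombB; apply: ker.
by rewrite zcombB eq_vw subrr.
Qed.

Lemma covers_zcomb {G : zmodType} {d : nat} (g : 'I_d -> G) (k : nat) (v : G) :
  covers g k -> exists a : 'cV[int]_d, v = \sum_i g i *~ a i 0.
Proof.
move=> /(_ v) [c _ ->]; exists (\col_i (c i)%:Z).
by apply: eq_bigr => i _; rewrite mxE pmulrn.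
Qed.

(** If [s j = 0], the [j]-th basis vector is killed by [U *m M *m V], a product of injective
    maps. *)
Lemma smith_factor_gt0 {d : nat} {G : finZmodType} {g : 'I_d -> G}
    {M U V : 'M[int]_d} {s : 'I_d -> nat} (j : 'I_d) :
  is_kernel_basis g M -> is_smith_decomposition M U V s -> (0 < s j)%N.
Proof.
case=> injM _ [Uunit Vunit sE _]; rewrite lt0n; apply/eqP => sj0.
have : U *m M *m V *m delta_mx j (0 : 'I_1) = 0.
  rewrite -sE mul_diag_mx; apply/colP => i; rewrite !mxE.
  by case: eqP => [->|]; rewrite ?sj0 ?mul0r ?mulr0.
rewrite -!mulmxA => /(congr1 (mulmx (invmx U))); rewrite mulKmx // mulmx0.
move=> /injM /(congr1 (mulmx (invmx V))); rewrite mulKmx // mulmx0.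
by move/colP/(_ j); rewrite !mxE !eqxx.
Qed.

(** The relation lattice scales by [m]: the diagonal matrix of the [m * s j] is [m U M V], and [U],
    [V] cancel over the integers. *)
Lemma dilate_ker {d : nat} {G : finZmodType} {g : 'I_d -> G}
    {M U V : 'M[int]_d} {s : 'I_d -> nat} (m : nat) (a : 'cV[int]_d) :
  is_kernel_basis g M -> is_smith_decomposition M U V s ->
  (0 < m)%N ->
  \sum_i proper_generator (fun i => m * s i)%N U i *~ a i 0 = 0 <->
  exists2 b : 'cV[int]_d, \sum_i g i *~ b i 0 = 0 & a = m%:Z *: b.
Proof.
move=> kerM smithM m0.
have ms0 j : (0 < m * s j)%N by rewrite muln_gt0 m0 (smith_factor_gt0 j kerM smithM).
have [Uunit Vunit sE _] := smithM; have [_ kerME] := kerM.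
have diagE (b : 'cV[int]_d) : diag_mx (\row_j (m * s j)%N%:Z) *m b =
    U *m (m%:Z *: (M *m (V *m b))).
  rewrite -scalemxAr !mulmxA -sE !mul_diag_mx; apply/colP => j.
  by rewrite !mxE PoszM mulrA.
apply: (iff_trans (proper_generator_ker _ U a ms0)).
split=> [[b]|[_ /kerME [b ->] ->]].
  rewrite diagE => /(congr1 (mulmx (invmx U))); rewrite !mulKmx // => ->.
  by exists (M *m (V *m b)) => //; apply/kerME; exists (V *m b).
by exists (invmx V *m b); rewrite diagE mulKVmx.
Qed.

Lemma delta_zcomb {G : zmodType} {d : nat} (g : 'I_d -> G) (i : 'I_d) :
  \sum_j g j *~ (delta_mx i 0 : 'cV[int]_d) j 0 = g i.
Proof.
rewrite (bigD1 i) //= mxE !eqxx mulr1z big1 ?addr0 // => j /negPf ji.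
by rewrite mxE ji mulr0z.
Qed.

(** * The lower bound [ell] and the extremal density *)

(** The [d]-th root of [n / Delta R d] is the integer [x], so the ceiling changes nothing. *)
Lemma ell_eq {R : realType} {d n x : nat} :
  (0 < d)%N -> 0 < Delta R d -> n%:R = Delta R d * x%:R ^+ d ->
  ell R d n = x%:Z - d%:Z.
Proof.
move=> d0 Delta0 nE; rewrite /ell nE mulrAC divff ?gt_eqF // mul1r.
rewrite -powR_mulrn // -powRrM mulfV ?pnatr_eq0 -?lt0n // powRr1 //.
by rewrite [x%:R]pmulrn intrKceil.
Qed.

Lemma order_leq_Delta {R : realType} {d : nat} {G : finZmodType} {T : {set G}} :
  (0 < d)%N -> 0 < Delta R d -> is_cay_digraph T d ->
  #|G|%:R <= Delta R d * (cay_diameter T + d)%:R ^+ d.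
Proof.
move=> d0 Delta0 cayT; have [_ _ Td] := cayT.
rewrite -natrX -ler_pdivrMr ?ltr0n ?expn_gt0 ?addn_gt0 ?d0 ?orbT //.
apply: ub_le_sup; last by exists G, T; split=> //; rewrite /solid_density Td.
(* An unbounded set of densities would have the junk supremum 0. *)
by apply: contrapT => nub; move: Delta0; rewrite /Delta sup_out ?ltxx // => -[].
Qed.

(** * The dilate as a Cayley digraph, and its order *)

Lemma is_cay_digraph_dilate {d : nat} {G : finZmodType} {g : 'I_d -> G}
    {M U V : 'M[int]_d} {s : 'I_d -> nat} {k : nat} (m : nat) :
  is_kernel_basis g M -> is_smith_decomposition M U V s -> (0 < m)%N ->
  injective g -> (forall i, g i != 0) ->
  covers (proper_generator (fun i => m * s i)%N U) k ->
  is_cay_digraph (dilate m s U) d.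
Proof.
move=> kerM smithM m0 g_inj g_neq0 cov; set h := proper_generator _ _ in cov.
(* Relations of [h] are multiples of relations of [g], hence relations of [g]. Taking [a] zero or a
   unit vector shows the [h i] nonzero and distinct. *)
have h_eq i (a : 'cV[int]_d) : h i = \sum_j h j *~ a j 0 ->
    g i = \sum_j g j *~ a j 0.
  move=> hi; apply: subr0_eq; rewrite -(delta_zcomb g i) -zcombB.
  have /(dilate_ker _ _ kerM smithM m0) [b gb ->] :
      \sum_j h j *~ (delta_mx i 0 - a) j 0 = 0.
    by rewrite zcombB delta_zcomb hi subrr.
  under eq_bigr => j _ do rewrite mxE mulrC mulrzA.
  by rewrite -mulrz_suml gb mul0rz.
split.
- apply/imsetP => -[i _ h0]; have /negP := g_neq0 i; apply; apply/eqP.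
  rewrite (h_eq i 0); first by rewrite big1 // => j _; rewrite mxE.
  by apply: (etrans (esym h0)); rewrite big1 // => j _; rewrite mxE.
- exact: covers_gen cov.
rewrite card_imset ?card_ord // => i j hij; apply: g_inj.
by rewrite -(delta_zcomb g j); apply: h_eq; rewrite delta_zcomb.
Qed.

(** For [m = 1] both families have the same relations, so [#|G|] is the product of the [s j]; each
    factor then gains [m]. *)
Lemma card_dilate {d : nat} {G : finZmodType} {g : 'I_d -> G}
    {M U V : 'M[int]_d} {s : 'I_d -> nat} {k : nat} (m : nat) :
  is_kernel_basis g M -> is_smith_decomposition M U V s -> (0 < m)%N ->
  covers g k ->
  #|{: cyclic_sum (fun i => m * s i)%N}| = (m ^ d * #|G|)%N.
Proof.
move=> kerM smithM m0 cov; have [Uunit _ _ _] := smithM.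
have s0 j := smith_factor_gt0 j kerM smithM.
have s1 j : (0 < 1 * s j)%N by rewrite mul1n.
have ker1 := dilate_ker 1 _ kerM smithM isT.
have -> : #|G| = #|{: cyclic_sum (fun i => 1 * s i)%N}|.
  apply/eqP; rewrite eqn_leq; apply/andP; split.
    apply: (ker_leq_card g (proper_generator (fun i => 1 * s i)%N U)) => [v|a].
      exact: covers_zcomb cov.
    by move=> /ker1 [b gb ->]; rewrite scale1r.
  apply: (ker_leq_card (proper_generator (fun i => 1 * s i)%N U) g) => [v|a ga].
    exact: proper_generator_surj.
  by apply/ker1; exists a; rewrite ?scale1r.
rewrite !card_cyclic_sum // => [|j]; last by rewrite muln_gt0 m0 s0.
rewrite !big_split /= prod_nat_const card_ord.
by rewrite [in RHS]big1 // mul1n.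
Qed.

Theorem theorem4 (R : realType) (d : nat) (G : finZmodType) (T : {set G})
    (x : nat) :
  (1 <= d)%N ->
  is_tight_digraph R T d ->
  Cset R d x%:R ->
  #|G|%:R = Delta R d * x%:R ^+ d ->
  forall (s : 'I_d -> nat) (U : 'M[int]_d),
    is_smith_presentation T s U ->
    forall m : nat, (1 <= m)%N -> is_tight_digraph R (dilate m s U) d.
Proof.
move=> d0 [[T0 genT cardT] tightT] _ GE s U [g [M [V [g_inj TE kerM smithM]]]] m m0.
(* Positivity comes from [0 < #|G|]; [x = 0] is excluded because [0 ^+ d = 0] when [1 <= d]. *)
have Delta0 : 0 < Delta R d.
  have : 0 < Delta R d * x%:R ^+ d.
    by rewrite -GE ltr0n; apply/card_gt0P; exists 0.
  have [->|/eqP x0] := eqVneq x 0%N; first by rewrite expr0n gtn_eqF // mulr0 ltxx.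
  by rewrite pmulr_lgt0 // exprn_gt0 // ltr0n lt0n; apply/eqP.
have diamT : (cay_diameter T + d)%N = x.
  move: tightT; rewrite /tightness cardT (ell_eq d0 Delta0 GE).
  by move/eqP; rewrite opprB addrA subr_eq0 -PoszD => /eqP [].
have cov : covers g (cay_diameter T).
  by rewrite TE; apply: covers_cay_diameter; rewrite -TE.
have [Uunit _ _ _] := smithM.
have cov_m : covers (proper_generator (fun i => m * s i)%N U)
    (m * cay_diameter T + d * m.-1)%N.
  apply: (covers_dilate g _ _ _ m0 _ _ cov) => [v|a ga].
    exact: proper_generator_surj.
  suff -> : \sum_i proper_generator (fun i => m * s i)%N U i *~ (m%:Z * a i 0) =
      \sum_i proper_generator (fun i => m * s i)%N U i *~ (m%:Z *: a) i 0.
    by apply/(dilate_ker _ _ kerM smithM m0); exists a.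
  by apply: eq_bigr => i _; rewrite mxE.
have cay_m : is_cay_digraph (dilate m s U) d.
  apply: (is_cay_digraph_dilate m kerM smithM m0 g_inj _ cov_m) => i.
  by apply: contraNneq T0 => <-; rewrite TE imset_f.
split=> //.
have cardE : #|{: cyclic_sum (fun i => m * s i)%N}|%:R =
    Delta R d * (m * x)%N%:R ^+ d.
  rewrite (card_dilate m kerM smithM m0 cov) natrM GE natrX natrM exprMn.
  by rewrite mulrCA.
have diam_le : (cay_diameter (dilate m s U) + d <= m * x)%N.
  apply: (@leq_trans (m * cay_diameter T + d * m.-1 + d)).
    by rewrite leq_add2r; apply: cay_diameter_leq.
  (* With [k] the diameter of [T], [m k + d (m - 1) + d = m (k + d) = m x]: the shift by [d] absorbs
     the remainders exactly. *)
  by rewrite -addnA -mulnSr prednK // -diamT mulnDr (mulnC d).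
(* The density bound compares two [d]-th powers after cancelling [Delta R d]; [0 < d] allows taking
   roots. *)
have diam_ge : (m * x <= cay_diameter (dilate m s U) + d)%N.
  have := order_leq_Delta d0 Delta0 cay_m.
  by rewrite cardE ler_pM2l // -!natrX ler_nat leq_exp2r.
have diamE : (cay_diameter (dilate m s U) + d)%N = (m * x)%N.
  by apply/eqP; rewrite eqn_leq diam_le.
have [_ _ card_m] := cay_m.
rewrite /tightness card_m (ell_eq d0 Delta0 cardE) -diamE PoszD addrK.
exact: subrr.
Qed.
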